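(* Let $s=x+iy\in{\mathbb S}^{+}$ be a non-trivial zero of the Riemann zeta-function $\zeta$. Then $$\sum_{k=1}^{\infty}(-1)^{k+1}Z_{k+1}(x,y)=\frac12 .$$
   Context: ${\mathbb S}^{+}=\{s\in{\mathbb C}: \frac12<{\rm Re}(s)<1,\ {\rm Im}(s)>0\}$ is the critical half-strip. $\zeta$ denotes the Riemann zeta-function (analytically continued); its non-trivial zeros are those zeros lying in the strip $0<{\rm Re}(s)<1$. For $x>\frac12$, $y\in{\mathbb R}$ and every integer $k\ge 1$, define $$Z_{k+1}(x,y)=\frac{1}{\zeta(2x)}\sum_{n=1}^{\infty}\frac{\cos\left[y\log\left(1+\frac{k}{n}\right)\right]}{[n(n+k)]^{x}} .$$ *)

(* Defs.v *)
From Stdlib Require Import Reals.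
From Coquelicot Require Export Coquelicot.

Open Scope R_scope.

Definition Cexp (z : C) : C :=
  (exp (Re z) * cos (Im z), exp (Re z) * sin (Im z)).

(* The n-th term n^{-s} of the Dirichlet series of zeta; meaningful for n >= 1. *)
Definition dirichlet_term (s : C) (n : nat) : C :=
  Cexp (Copp s * RtoC (ln (INR n)))%C.

(* The disc may have to be shrunk to avoid points where [f] is not analytic. *)
Definition analytic_at (f : C -> C) (z0 : C) : Prop :=
  exists (r : R) (a : nat -> C),
    0 < r /\
    forall z : C, Cmod (z - z0)%C < r ->
      @is_pseries C_AbsRing C_NormedModule a (z - z0)%C (f z).

(* [zeta] is the analytic continuation to C \ {1} of the sum of n^{-s}.
   By the identity theorem this determines [zeta] everywhere except at the
   pole 1, where its value is left arbitrary. *)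
Definition is_Riemann_zeta (zeta : C -> C) : Prop :=
  (forall s : C, 1 < Re s ->
     @is_series C_AbsRing C_NormedModule
       (fun j : nat => dirichlet_term s (S j)) (zeta s)) /\
  (forall s : C, s <> RtoC 1 -> analytic_at zeta s).

Definition nontrivial_zero (zeta : C -> C) (s : C) : Prop :=
  zeta s = RtoC 0 /\ 0 < Re s < 1.

Definition critical_half_strip (s : C) : Prop :=
  1 / 2 < Re s < 1 /\ 0 < Im s.

(* [Zfun zeta (k + 1) x y] is Z_{k+1}(x,y), for k >= 1 and x > 1/2.  It is
   complex-valued only because [zeta] is.  [Series] starts at index 0, hence
   the shift n = S j; the series converges absolutely since x > 1/2. *)
Definition Zfun (zeta : C -> C) (m : nat) (x y : R) : C :=
  let k := (m - 1)%nat in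
  (RtoC 1 / zeta (RtoC (2 * x)) *
   RtoC (Series (fun j : nat => (
     let n := S j in
     cos (y * ln (1 + INR k / INR n)) / Rpower (INR n * INR (n + k)) x)%R)))%C.

(* Main.v *)
Require Import Defs.
From Stdlib Require Import Reals Lra Lia.
From Coquelicot Require Import Coquelicot.
Open Scope R_scope.

(** Write [s = x + iy] and let [b n = (-1)^n (n+1)^(-s)] be the terms of the
    alternating series [eta s = sum b n = (1 - 2^(1-s)) zeta s].  Expanding
    [|eta s|^2] formally along diagonals gives
    [zeta (2x) + 2 sum_k (-1)^k sum_n cos (y log (1 + k/n)) / (n (n+k))^x],
    and since [eta s = 0] at a zero of zeta, dividing by [2 zeta (2x)] gives the
    result.  The expansion is not absolutely convergent; what makes it
    legitimate is that the zero of [eta] turns the partial sums [E N] of [b]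
    into tails, so that [E N = O(N^(-x))] ([alternating_sum_bound]).  Summing
    the first [K] diagonals gives [sum_n Re (b n * conj (E (n+K) - E n))].  As
    [b n] and [E n] are both [O(n^(-x))] and [2x > 1], the part with [E (n+K)]
    vanishes as [K] grows, by dominated convergence ([tannery]), while
    [2 Re (b n * conj (E n)) - |b n|^2] is the increment of [|E n|^2], a
    sequence tending to 0, so the remaining part is half of
    [sum |b n|^2 = zeta (2x)].  This is [autocorrelation_series]; it is applied
    to the real and imaginary parts of [b] separately.

    The other half of the proof shows that the alternating series, with its
    terms grouped in pairs, does vanish at [s].  The relation
    [eta = (1 - 2^(1-s)) zeta] is a rearrangement of Dirichlet series for
    [Re s > 1] ([eta_part_right]).  The horizontal line through [s] avoids the
    pole 1 because [y <> 0], and on it the real and imaginary parts of both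
    sides are real analytic functions of [Re s], for [Re s > 0]
    ([real_analytic_at_line], [real_analytic_at_eta_part]); the identity theorem
    on a half-line ([identity_theorem_half_line]) then carries the relation
    left to [s]. *)

(** * Dominated convergence and autocorrelations of series *)

Lemma ex_series_dominated (a B : nat -> R) :
  (forall n, Rabs (a n) <= B n) -> ex_series B -> ex_series a.
Proof. exact (@ex_series_le _ R_CompleteNormedModule a B). Qed.

Lemma is_series_R_sum (a : nat -> R) (l : R) :
  is_series a l <-> is_lim_seq (sum_f_R0 a) l.
Proof.
  split; intro H.
  - apply is_lim_seq_Reals, is_series_Reals, H.
  - apply is_series_Reals, is_lim_seq_Reals, H.
Qed.

Lemma is_lim_seq_sum (u : nat -> nat -> R) (v : nat -> R) (N : nat) :
  (forall n, is_lim_seq (fun K => u K n) (v n)) ->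
  is_lim_seq (fun K => sum_f_R0 (u K) N) (sum_f_R0 v N).
Proof.
  intro H. induction N as [|N IH]; simpl; [apply H|].
  apply is_lim_seq_plus'; [exact IH | apply H].
Qed.

(** Split the series at [N]: finitely many terms converge, and the remaining
    differences are bounded by twice the tail of [B]. *)
Lemma tannery (u : nat -> nat -> R) (v B : nat -> R) :
  (forall K n, Rabs (u K n) <= B n) -> ex_series B ->
  (forall n, is_lim_seq (fun K => u K n) (v n)) ->
  is_lim_seq (fun K => Series (u K)) (Series v).
Proof.
  intros Hu HB Hlim.
  assert (Hv : forall n, Rabs (v n) <= B n).
  { intro n.
    apply (is_lim_seq_le (fun K => Rabs (u K n)) (fun _ => B n)
             (Rabs (v n)) (B n)); auto using is_lim_seq_const.
    apply (is_lim_seq_abs _ (v n)), Hlim. }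
  set (B2 := fun n => 2 * B n).
  assert (HB2 : ex_series B2) by exact (ex_series_scal 2 B HB).
  assert (Hd : forall K n, Rabs (u K n - v n) <= B2 n).
  { intros K n. unfold B2. specialize (Hu K n). specialize (Hv n).
    apply Rle_trans with (Rabs (u K n) + Rabs (v n)); [|lra].
    unfold Rminus; rewrite <- (Rabs_Ropp (v n)); apply Rabs_triang. }
  assert (HdN : forall K N, Rabs (Series (u K) - Series v)
            <= sum_f_R0 (fun n => Rabs (u K n - v n)) N
               + (Series B2 - sum_f_R0 B2 N)).
  { intros K N.
    assert (E : ex_series (fun n => Rabs (u K n - v n))).
    { apply (ex_series_dominated _ B2); auto.
      intro n; rewrite Rabs_Rabsolu; apply Hd. }
    rewrite <- Series_minus by (eapply ex_series_dominated; eauto).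
    apply Rle_trans with (1 := Series_Rabs _ E).
    rewrite (Series_incr_n _ (S N)), (Series_incr_n B2 (S N));
      try assumption; try lia.
    simpl pred.
    assert (Series (fun k => Rabs (u K (S N + k)%nat - v (S N + k)%nat))
            <= Series (fun k => B2 (S N + k)%nat)); [|lra].
    apply Series_le; [intro n; split; [apply Rabs_pos | apply Hd]|].
    now apply -> (@ex_series_incr_n R_AbsRing R_NormedModule B2 (S N)). }
  apply is_lim_seq_spec. intro eps.
  destruct HB2 as [b Hb]. rewrite (is_series_unique _ _ Hb) in HdN.
  apply is_series_R_sum, is_lim_seq_spec in Hb.
  assert (He : 0 < eps / 2) by (generalize (cond_pos eps); lra).
  destruct (Hb (mkposreal _ He)) as [N HN].
  specialize (HN N (le_n N)); simpl in HN.
  assert (Hs : is_lim_seq (fun K => sum_f_R0 (fun n => Rabs (u K n - v n)) N) 0).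
  { replace 0 with (sum_f_R0 (fun _ : nat => 0) N)
      by (rewrite sum_cte; ring).
    apply is_lim_seq_sum. intro n.
    apply (proj1 (is_lim_seq_abs_0 (fun K => u K n - v n))).
    replace 0 with (v n - v n) by ring.
    apply is_lim_seq_minus'; [apply Hlim | apply is_lim_seq_const]. }
  apply is_lim_seq_spec in Hs.
  destruct (Hs (mkposreal _ He)) as [K0 HK]. exists K0. intros K HKK.
  specialize (HK K HKK); simpl in HK. specialize (HdN K N).
  apply Rabs_def2 in HN. apply Rabs_def2 in HK. lra.
Qed.

(** With [A n] the partial sums of [a], the first [K + 1] correlations add up to
    [sum_n a n * (A (n + K + 1) - A n)].  Since [A] is of the same order as
    [phi], the first half tends to 0 and the second telescopes through
    [A n ^ 2 - A (n-1) ^ 2 = 2 * a n * A n - a n ^ 2]. *)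
Lemma autocorrelation_series (a phi : nat -> R) (M : R) :
  0 <= M ->
  (forall n, Rabs (a n) <= phi n) ->
  (forall n, Rabs (sum_f_R0 a n) <= M * phi n) ->
  (forall n m, (n <= m)%nat -> phi m <= phi n) ->
  is_lim_seq phi 0 ->
  ex_series (fun n => (phi n) ^ 2) ->
  (forall k, ex_series (fun n => a n * a (n + S k)%nat)) /\
  is_series (fun k => Series (fun n => a n * a (n + S k)%nat))
    (- / 2 * Series (fun n => (a n) ^ 2)).
Proof.
  intros HM Ha HA Hmono Hphi Hsum.
  assert (Hpos : forall n, 0 <= phi n).
  { intro n. apply Rle_trans with (2 := Ha n), Rabs_pos. }
  assert (Hprod : forall u v n m C, 0 <= C -> (n <= m)%nat ->
            Rabs u <= phi n -> Rabs v <= C * phi m ->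
            Rabs (u * v) <= C * phi n ^ 2).
  { intros u v n m C HC Hnm Hu Hv. rewrite Rabs_mult.
    specialize (Hmono n m Hnm).
    replace (C * phi n ^ 2) with (phi n * (C * phi n)) by ring.
    apply Rmult_le_compat; auto using Rabs_pos.
    apply Rle_trans with (1 := Hv). now apply Rmult_le_compat_l. }
  assert (HsumM : forall C, ex_series (fun n => C * phi n ^ 2)).
  { intro C. exact (ex_series_scal C _ Hsum). }
  assert (Hex : forall k, ex_series (fun n => a n * a (n + S k)%nat)).
  { intro k. apply (ex_series_dominated _ (fun n => 1 * phi n ^ 2)); auto.
    intro n. apply (Hprod _ _ n (n + S k)%nat); [lra | lia | auto |].
    rewrite Rmult_1_l; auto. }
  assert (HaA : forall j, ex_series (fun n => a n * sum_f_R0 a (n + j))).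
  { intro j. apply (ex_series_dominated _ (fun n => M * phi n ^ 2)); auto.
    intro n. apply (Hprod _ _ n (n + j)%nat); auto; lia. }
  split; [exact Hex|].
  apply is_series_R_sum.
  assert (Hpartial : forall K,
    sum_f_R0 (fun k => Series (fun n => a n * a (n + S k)%nat)) K
    = Series (fun n => a n * sum_f_R0 a (n + S K))
      - Series (fun n => a n * sum_f_R0 a (n + 0))).
  { intro K. induction K as [|K IH]; simpl sum_f_R0.
    - rewrite <- Series_minus by apply HaA.
      apply Series_ext. intro n.
      rewrite <- !plus_n_Sm, <- !plus_n_O. simpl. ring.
    - rewrite IH.
      assert (E : Series (fun n => a n * sum_f_R0 a (n + S (S K)))
                = Series (fun n => a n * sum_f_R0 a (n + S K))
                  + Series (fun n => a n * a (n + S (S K))%nat)).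
      { rewrite <- Series_plus by auto.
        apply Series_ext. intro n.
        rewrite <- (plus_n_Sm n (S K)). simpl. ring. }
      rewrite E. ring. }
  assert (Hdiag : Series (fun n => a n * sum_f_R0 a (n + 0))
                  = / 2 * Series (fun n => (a n) ^ 2)).
  { assert (Ha2 : ex_series (fun n => a n ^ 2)).
    { apply (ex_series_dominated _ (fun n => 1 * phi n ^ 2)); auto.
      intro n. replace (a n ^ 2) with (a n * a n) by ring.
      apply (Hprod _ _ n n); auto; try lra. rewrite Rmult_1_l; auto. }
    assert (H2 : is_series (fun n => 2 * (a n * sum_f_R0 a (n + 0)) - a n ^ 2) 0).
    { apply is_series_R_sum.
      apply is_lim_seq_ext with (fun n => sum_f_R0 a n ^ 2).
      - intro n. induction n as [|n IH].
        + simpl. ring.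
        + rewrite (tech5 (fun n => 2 * (a n * sum_f_R0 a (n + 0)) - a n ^ 2)).
          rewrite <- IH, <- plus_n_O, (tech5 a n). ring.
      - apply <- is_lim_seq_abs_0.
        apply (is_lim_seq_le_le (fun _ => 0) _ (fun n => (M * phi n) * (M * phi n))).
        + intro n. split; [apply Rabs_pos|].
          rewrite <- RPow_abs.
          replace (Rabs (sum_f_R0 a n) ^ 2)
            with (Rabs (sum_f_R0 a n) * Rabs (sum_f_R0 a n)) by ring.
          apply Rmult_le_compat; auto using Rabs_pos.
        + apply is_lim_seq_const.
        + replace 0 with ((M * 0) * (M * 0)) by ring.
          apply is_lim_seq_mult';
            apply (is_lim_seq_mult' (fun _ => M)); auto using is_lim_seq_const. }
    apply is_series_unique in H2.
    rewrite Series_minus in H2; auto.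
    - rewrite Series_scal_l in H2. lra.
    - exact (ex_series_scal 2 _ (HaA 0%nat)). }
  apply is_lim_seq_ext with (fun K => Series (fun n => a n * sum_f_R0 a (n + S K))
      - Series (fun n => a n * sum_f_R0 a (n + 0))).
  { intro K. now rewrite Hpartial. }
  rewrite Hdiag.
  replace (- / 2 * Series (fun n => a n ^ 2))
    with (Series (fun _ : nat => 0) - / 2 * Series (fun n => a n ^ 2)).
  2: { replace (Series (fun _ : nat => 0)) with 0; [ring|].
       symmetry. apply is_series_unique, is_series_R_sum.
       apply is_lim_seq_ext with (fun _ => 0); [|apply is_lim_seq_const].
       intro n. rewrite sum_cte. ring. }
  apply is_lim_seq_minus'; [|apply is_lim_seq_const].
  apply (tannery _ _ (fun n => M * phi n ^ 2)); auto.
  - intros K n. apply (Hprod _ _ n (n + S K)%nat); auto; lia.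
  - intro n.
    apply <- is_lim_seq_abs_0.
    apply (is_lim_seq_le_le (fun _ => 0) _ (fun K => phi n * (M * phi (K + S n)%nat))).
    + intro K. split; [apply Rabs_pos|]. rewrite Rabs_mult.
      replace (K + S n)%nat with (n + S K)%nat by lia.
      apply Rmult_le_compat; auto using Rabs_pos.
    + apply is_lim_seq_const.
    + replace 0 with (phi n * (M * 0)) by ring.
      repeat (apply is_lim_seq_mult'; [apply is_lim_seq_const|]).
      now apply -> (is_lim_seq_incr_n phi (S n)).
Qed.

(** When the full sum is 0, a partial sum is the opposite of a tail; grouping the
    tail in consecutive pairs makes the bounds on the pairs telescope. *)
Lemma alternating_sum_bound (a phi : nat -> R) (M : R) :
  0 <= M ->
  (forall n, Rabs (a n + a (S n)) <= M * (phi n - phi (S n))) ->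
  (forall n, Rabs (a n) <= phi n) ->
  (forall n m, (n <= m)%nat -> phi m <= phi n) ->
  is_lim_seq phi 0 ->
  is_lim_seq (fun m => sum_f_R0 a (2 * m + 1)) 0 ->
  forall n, Rabs (sum_f_R0 a n) <= M * phi n.
Proof.
  intros HM Hpair Ha Hmono Hphi Hodd n.
  assert (Hsub : forall k, is_lim_seq (fun p => phi (p + k)%nat) 0).
  { intro k. now apply -> (is_lim_seq_incr_n phi k). }
  assert (Hlim : is_lim_seq (fun p => sum_f_R0 a (n + 2 * p)) 0).
  { destruct (Nat.Even_or_Odd n) as [[q Hq]|[q Hq]]; subst n.
    - replace 0 with (0 - 0) by ring.
      apply is_lim_seq_ext with
        (fun p => sum_f_R0 a (2 * (p + q) + 1) - a (2 * (p + q) + 1)%nat).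
      { intro p. replace (2 * (p + q) + 1)%nat with (S (2 * q + 2 * p)) by lia.
        rewrite tech5. ring. }
      apply is_lim_seq_minus'.
      + now apply -> (is_lim_seq_incr_n (fun m => sum_f_R0 a (2 * m + 1)) q).
      + apply <- is_lim_seq_abs_0.
        apply (is_lim_seq_le_le (fun _ => 0) _ (fun p => phi (p + 0)%nat)).
        * intro p. split; [apply Rabs_pos|].
          apply Rle_trans with (1 := Ha _), Hmono. lia.
        * apply is_lim_seq_const.
        * apply Hsub.
    - apply is_lim_seq_ext with (fun p => sum_f_R0 a (2 * (p + q) + 1)).
      { intro p. f_equal. lia. }
      now apply -> (is_lim_seq_incr_n (fun m => sum_f_R0 a (2 * m + 1)) q). }
  assert (Hbound : forall p, Rabs (sum_f_R0 a (n + 2 * p) - sum_f_R0 a n)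
            <= M * (phi (S n) - phi (S (n + 2 * p)))).
  { induction p as [|p IH].
    - replace (n + 2 * 0)%nat with n by lia. rewrite !Rminus_diag, Rabs_R0. lra.
    - replace (n + 2 * S p)%nat with (S (S (n + 2 * p))) by lia.
      rewrite !tech5.
      replace (sum_f_R0 a (n + 2 * p) + a (S (n + 2 * p)) + a (S (S (n + 2 * p)))
               - sum_f_R0 a n)
        with (sum_f_R0 a (n + 2 * p) - sum_f_R0 a n
              + (a (S (n + 2 * p)) + a (S (S (n + 2 * p))))) by ring.
      apply Rle_trans with (1 := Rabs_triang _ _).
      assert (H1 := Hpair (S (n + 2 * p))).
      assert (H2 := Hmono (S (S (n + 2 * p))) (S (S (S (n + 2 * p)))) ltac:(lia)).
      nra. }
  assert (Hnonneg : forall k, 0 <= phi k).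
  { intro k. apply Rle_trans with (2 := Ha k), Rabs_pos. }
  replace (Rabs (sum_f_R0 a n)) with (Rabs (0 - sum_f_R0 a n))
    by (rewrite Rminus_0_l; apply Rabs_Ropp).
  apply (is_lim_seq_le (fun p => Rabs (sum_f_R0 a (n + 2 * p) - sum_f_R0 a n))
    (fun _ => M * phi n) (Rabs (0 - sum_f_R0 a n)) (M * phi n)).
  - intro p. apply Rle_trans with (1 := Hbound p).
    apply Rmult_le_compat_l; [exact HM|].
    assert (H1 := Hnonneg (S (n + 2 * p))). assert (H2 := Hmono n (S n) ltac:(lia)). lra.
  - apply (is_lim_seq_abs _ (0 - sum_f_R0 a n)).
    apply is_lim_seq_minus'; [exact Hlim | apply is_lim_seq_const].
  - apply is_lim_seq_const.
Qed.

(** * Real analytic functions and the identity theorem on a half-line *)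

Definition real_analytic_at (f : R -> R) (t0 : R) : Prop :=
  exists (r : R) (a : nat -> R),
    0 < r /\ forall w, Rabs w < r -> is_pseries a w (f (t0 + w)).

Lemma CV_radius_gt_of_pseries (a : nat -> R) (r : R) :
  (forall w, Rabs w < r -> ex_pseries a w) ->
  forall w, Rabs w < r -> Rbar_lt (Rabs w) (CV_radius a).
Proof.
  intros H w Hw.
  set (w' := (Rabs w + r) / 2).
  assert (Hw0 := Rabs_pos w).
  assert (Hw' : Rabs w' = w') by (apply Rabs_pos_eq; unfold w'; lra).
  apply Rbar_lt_le_trans with (Rabs w').
  { rewrite Hw'; simpl; unfold w'; lra. }
  apply Rbar_not_lt_le. intro Hlt. apply (CV_disk_outside _ _ Hlt).
  apply ex_series_lim_0, (proj1 (ex_pseries_R _ _)), H. rewrite Hw'. unfold w'; lra.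
Qed.

Lemma real_analytic_at_ext (f g : R -> R) (t0 : R) :
  (forall t, f t = g t) -> real_analytic_at f t0 -> real_analytic_at g t0.
Proof.
  intros E (r & a & Hr & H). exists r, a. split; auto.
  intros w Hw. rewrite <- E. auto.
Qed.

Lemma real_analytic_at_plus (f g : R -> R) (t0 : R) :
  real_analytic_at f t0 -> real_analytic_at g t0 ->
  real_analytic_at (fun t => f t + g t) t0.
Proof.
  intros (r & a & Hr & Ha) (q & b & Hq & Hb).
  exists (Rmin r q), (PS_plus a b). split.
  { now apply Rmin_glb_lt. }
  intros w Hw. apply (is_pseries_plus a b).
  - apply Ha. apply Rlt_le_trans with (1 := Hw), Rmin_l.
  - apply Hb. apply Rlt_le_trans with (1 := Hw), Rmin_r.
Qed.

Lemma real_analytic_at_mult (f g : R -> R) (t0 : R) :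
  real_analytic_at f t0 -> real_analytic_at g t0 ->
  real_analytic_at (fun t => f t * g t) t0.
Proof.
  intros (r & a & Hr & Ha) (q & b & Hq & Hb).
  exists (Rmin r q), (PS_mult a b). split.
  { now apply Rmin_glb_lt. }
  intros w Hw.
  assert (Hwr : Rabs w < r) by apply Rlt_le_trans with (1 := Hw), Rmin_l.
  assert (Hwq : Rabs w < q) by apply Rlt_le_trans with (1 := Hw), Rmin_r.
  apply is_pseries_mult; auto.
  - apply CV_radius_gt_of_pseries with r; auto.
    intros z Hz. eexists. now apply Ha.
  - apply CV_radius_gt_of_pseries with q; auto.
    intros z Hz. eexists. now apply Hb.
Qed.

Lemma real_analytic_at_const (c t0 : R) : real_analytic_at (fun _ => c) t0.
Proof.
  exists 1, (fun n => match n with O => c | S _ => 0 end). split; [lra|].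
  intros w _. apply is_pseries_R, is_series_R_sum.
  apply is_lim_seq_ext with (fun _ => c); [|apply is_lim_seq_const].
  induction n as [|n IH]; simpl; [ring|]. rewrite <- IH. ring.
Qed.

Lemma real_analytic_at_opp (f : R -> R) (t0 : R) :
  real_analytic_at f t0 -> real_analytic_at (fun t => - f t) t0.
Proof.
  intro H. apply real_analytic_at_ext with (fun t => -1 * f t).
  { intro t; ring. }
  apply real_analytic_at_mult; auto using real_analytic_at_const.
Qed.

Lemma is_series_exp (t : R) :
  is_series (fun k => / INR (Factorial.fact k) * t ^ k) (exp t).
Proof. exact (proj1 (is_pseries_R _ _ _) (is_exp_Reals t)). Qed.

Lemma real_analytic_at_exp (c t0 : R) :
  real_analytic_at (fun t => exp (c * t)) t0.
Proof.
  exists 1, (fun n => exp (c * t0) * (c ^ n * / INR (Factorial.fact n))). split; [lra|].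
  intros w _. apply is_pseries_R.
  replace (exp (c * (t0 + w))) with (exp (c * t0) * exp (c * w))
    by (rewrite <- exp_plus; f_equal; ring).
  apply is_series_ext with (fun n => scal (exp (c * t0)) (/ INR (Factorial.fact n) * (c * w) ^ n)).
  { intro n. unfold scal; simpl; unfold mult; simpl. rewrite Rpow_mult_distr. ring. }
  apply (is_series_scal (V := R_NormedModule) (exp (c * t0)) _ (exp (c * w))).
  apply is_series_exp.
Qed.

(** The sum is continuous at 0, where its value is the constant coefficient. *)
Lemma pseries_zero_right_coef0 (a : nat -> R) (r : R) :
  0 < r -> (forall w, Rabs w < r -> ex_pseries a w) ->
  (forall w, 0 < w < r -> PSeries a w = 0) -> a 0%nat = 0.
Proof.
  intros Hr Hex Hz.
  assert (Hl : is_lim_seq (fun k => PSeries a (r / 2 * / INR (S k))) (PSeries a 0)).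
  { apply is_lim_seq_continuous with (f := PSeries a).
    - apply PSeries_continuity, CV_radius_gt_of_pseries with r; auto.
      rewrite Rabs_R0; lra.
    - replace 0 with (r / 2 * 0) by ring.
      apply is_lim_seq_mult'; [apply is_lim_seq_const|].
      apply -> (is_lim_seq_incr_1 (fun k => / INR k)).
      apply (is_lim_seq_inv _ _ is_lim_seq_INR). discriminate. }
  rewrite PSeries_0 in Hl. apply is_lim_seq_unique in Hl.
  rewrite (Lim_seq_ext _ (fun _ => 0)), Lim_seq_const in Hl.
  - now injection Hl.
  - intro k. apply Hz.
    assert (Hk := RinvN_pos k). rewrite <- S_INR in Hk.
    assert (Hk1 : / INR (S k) <= 1).
    { rewrite <- Rinv_1. apply Rinv_le_contravar; [lra | apply (le_INR 1); lia]. }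
    split; nra.
Qed.

(** One-sided vanishing is enough, and it is all that is known at the left end
    of the interval on which a function has been shown to vanish: divide by the
    variable and repeat. *)
Lemma pseries_zero_right_coef (n : nat) : forall (a : nat -> R) (r : R),
  0 < r -> (forall w, Rabs w < r -> ex_pseries a w) ->
  (forall w, 0 < w < r -> PSeries a w = 0) -> a n = 0.
Proof.
  induction n as [|n IH]; intros a r Hr Hex Hz;
    assert (H0 := pseries_zero_right_coef0 a r Hr Hex Hz); [exact H0|].
  apply (IH (PS_decr_1 a) r Hr).
  - intros w Hw.
    apply CV_radius_inside. rewrite CV_radius_decr_1.
    now apply CV_radius_gt_of_pseries with r.
  - intros w Hw.
    assert (E := Hz w Hw). rewrite PSeries_decr_1_aux in E by exact H0.
    apply Rmult_integral in E. destruct E; [lra | assumption].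
Qed.

(** Push the left end of a half-line of zeros as far left as possible: at the
    infimum the function vanishes just to the right, so its power series there
    is 0 and it vanishes just to the left as well. *)
Lemma identity_theorem_half_line (h : R -> R) (alpha beta : R) :
  (forall t, alpha < t -> real_analytic_at h t) ->
  (forall t, beta < t -> h t = 0) ->
  forall t, alpha < t -> h t = 0.
Proof.
  intros Han Hbeta x Hx.
  destruct (Rlt_le_dec beta x) as [H|Hxb]; [auto|].
  (* The signs are reversed so that the infimum of left ends is a least upper
     bound; half-lines are stopped at [x] to keep [E] bounded. *)
  set (E := fun u => u <= - x /\ forall t, - u < t -> h t = 0).
  destruct (completeness E) as [W [Hub Hlub]].
  { exists (- x). intros u [Hu _]. exact Hu. }
  { exists (- beta). split; [lra|]. intros t Ht. apply Hbeta. lra. }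
  assert (HWx : W <= - x) by (apply Hlub; intros u [Hu _]; exact Hu).
  assert (Hright : forall t, - W < t -> h t = 0).
  { intros t Ht. destruct (Req_dec (h t) 0) as [|Hne]; auto. exfalso.
    assert (W <= - t); [|lra].
    apply Hlub. intros u [_ Hu].
    destruct (Rle_lt_dec u (- t)); auto. exfalso. apply Hne, Hu. lra. }
  destruct (Han (- W)) as (r & a & Hr & Ha); [lra|].
  assert (Ha0 : forall n, a n = 0).
  { intro n. apply (pseries_zero_right_coef n a r Hr).
    - intros w Hw. eexists. now apply Ha.
    - intros w Hw. rewrite <- (Hright (- W + w)) by lra.
      apply is_pseries_unique, Ha. rewrite Rabs_pos_eq; lra. }
  assert (Hloc : forall w, Rabs w < r -> h (- W + w) = 0).
  { intros w Hw. rewrite <- (is_pseries_unique _ _ _ (Ha w Hw)).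
    rewrite (PSeries_ext _ (fun _ => 0)) by exact Ha0. apply PSeries_const_0. }
  destruct (Req_dec W (- x)) as [->|Hne].
  { rewrite <- (Hloc 0) by (rewrite Rabs_R0; lra). f_equal; ring. }
  exfalso.
  set (W' := Rmin (- x) (W + r / 2)).
  assert (HW' : W' <= W).
  { apply Hub. split; [apply Rmin_l|].
    intros t Ht.
    destruct (Rlt_le_dec (- W) t) as [|Htw]; [auto|].
    assert (HW2 : W' <= W + r / 2) by apply Rmin_r.
    replace t with (- W + (t + W)) by ring. apply Hloc.
    apply Rabs_def1; lra. }
  revert HW'. unfold W', Rmin. destruct (Rle_dec (- x) (W + r / 2)); lra.
Qed.
(** * The alternating zeta series on a horizontal line *)

(** The shared properties of [cos (y * L)] and [- sin (y * L)], the real and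
    imaginary parts of [exp (- i * y * L)] with [L = ln n]; they let both parts
    of the Dirichlet series be treated at once. *)
Definition slowly_varying (Y : R) (c : R -> R) : Prop :=
  exists c' : R -> R, forall L,
    is_derive c L (c' L) /\ Rabs (c L) <= 1 /\ Rabs (c' L) <= Y.

Lemma slowly_varying_cos (y : R) : slowly_varying (Rabs y) (fun L => cos (y * L)).
Proof.
  exists (fun L => - y * sin (y * L)). intro L. split; [|split].
  - auto_derive; auto. ring.
  - apply Rabs_le, COS_bound.
  - rewrite Rabs_mult, Rabs_Ropp. rewrite <- (Rmult_1_r (Rabs y)) at 2.
    apply Rmult_le_compat_l; [apply Rabs_pos | apply Rabs_le, SIN_bound].
Qed.

Lemma slowly_varying_sin (y : R) : slowly_varying (Rabs y) (fun L => - sin (y * L)).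
Proof.
  exists (fun L => - y * cos (y * L)). intro L. split; [|split].
  - auto_derive; auto. ring.
  - rewrite Rabs_Ropp. apply Rabs_le, SIN_bound.
  - rewrite Rabs_mult, Rabs_Ropp. rewrite <- (Rmult_1_r (Rabs y)) at 2.
    apply Rmult_le_compat_l; [apply Rabs_pos | apply Rabs_le, COS_bound].
Qed.

Lemma increasing_of_derive_nonneg (f f' : R -> R) (a b : R) :
  a <= b -> (forall t, a <= t <= b -> is_derive f t (f' t)) ->
  (forall t, a <= t <= b -> 0 <= f' t) -> f a <= f b.
Proof.
  intros Hab Hd Hp.
  destruct (MVT_gen f a b f') as (t & Ht & E);
    rewrite ?Rmin_left, ?Rmax_right in * by exact Hab.
  - intros t Ht. apply Hd. lra.
  - intros t Ht. apply continuity_pt_filterlim, (ex_derive_continuous f).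
    exists (f' t). now apply Hd.
  - specialize (Hp t Ht). assert (0 <= b - a) by lra. nra.
Qed.

(** If [g] grows at least as fast as [f] varies, both [g - f] and [g + f]
    increase. *)
Lemma difference_dominated (f f' g g' : R -> R) (a b : R) :
  a <= b ->
  (forall t, a <= t <= b -> is_derive f t (f' t)) ->
  (forall t, a <= t <= b -> is_derive g t (g' t)) ->
  (forall t, a <= t <= b -> Rabs (f' t) <= g' t) ->
  Rabs (f a - f b) <= g b - g a.
Proof.
  intros Hab Hf Hg Hfg.
  assert (H1 : g a - f a <= g b - f b).
  { apply (increasing_of_derive_nonneg (fun t => g t - f t) (fun t => g' t - f' t)); auto.
    - intros t Ht. apply (is_derive_minus g f); auto.
    - intros t Ht. specialize (Hfg t Ht). apply Rabs_le_between in Hfg. lra. }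
  assert (H2 : g a + f a <= g b + f b).
  { apply (increasing_of_derive_nonneg (fun t => g t + f t) (fun t => g' t + f' t)); auto.
    - intros t Ht. apply (is_derive_plus g f); auto.
    - intros t Ht. specialize (Hfg t Ht). apply Rabs_le_between in Hfg. lra. }
  apply Rabs_le. lra.
Qed.

(** The derivative of [c * p * exp (- sigma * L)] is at most
    [(Y + r + sigma) * exp (- (sigma - r) * L)] in absolute value, and the
    right-hand side is the increment of an antiderivative of this bound.  A
    bound of this shape telescopes when it is summed over successive
    logarithms.  The factor [p] is 1 for the terms of the series and a Taylor
    polynomial of [exp (- w * L)] for its expansion in powers of [w]. *)
Lemma damped_difference (c p p' : R -> R) (Y sigma r a b : R) :
  slowly_varying Y c -> 0 <= r < sigma ->
  (forall L, is_derive p L (p' L)) ->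
  (forall L, 0 <= L -> Rabs (p L) <= exp (r * L)) ->
  (forall L, 0 <= L -> Rabs (p' L) <= r * exp (r * L)) ->
  0 <= a <= b ->
  Rabs (c a * p a * exp (- sigma * a) - c b * p b * exp (- sigma * b))
  <= (Y + r + sigma) / (sigma - r)
     * (exp (- (sigma - r) * a) - exp (- (sigma - r) * b)).
Proof.
  intros [c' Hc] Hr Hp Hpb Hpb' Hab.
  set (M := (Y + r + sigma) / (sigma - r)).
  replace (M * (exp (- (sigma - r) * a) - exp (- (sigma - r) * b)))
    with (- M * exp (- (sigma - r) * b) - - M * exp (- (sigma - r) * a)) by ring.
  apply (difference_dominated (fun L => c L * p L * exp (- sigma * L))
    (fun L => c' L * p L * exp (- sigma * L) + c L * p' L * exp (- sigma * L)
              - sigma * (c L * p L * exp (- sigma * L)))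
    (fun L => - M * exp (- (sigma - r) * L))
    (fun L => (Y + r + sigma) * exp (- (sigma - r) * L))).
  - lra.
  - intros t _. destruct (Hc t) as [Hct _].
    auto_derive.
    + repeat split; eexists; [apply Hct | apply Hp].
    + replace (Derive (fun x : R => c x) t) with (c' t)
        by (symmetry; now apply is_derive_unique).
      replace (Derive (fun x : R => p x) t) with (p' t)
        by (symmetry; now apply is_derive_unique).
      ring.
  - intros t _. auto_derive; auto. unfold M. field. lra.
  - intros t Ht.
    destruct (Hc t) as (_ & Hc1 & Hc2).
    assert (HL : 0 <= t) by lra.
    specialize (Hpb t HL). specialize (Hpb' t HL).
    replace (exp (- (sigma - r) * t)) with (exp (r * t) * exp (- sigma * t))
      by (rewrite <- exp_plus; f_equal; ring).
    assert (He := exp_pos (- sigma * t)). assert (He' := exp_pos (r * t)).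
    replace (c' t * p t * exp (- sigma * t) + c t * p' t * exp (- sigma * t)
              - sigma * (c t * p t * exp (- sigma * t)))
      with ((c' t * p t + c t * p' t + - sigma * (c t * p t)) * exp (- sigma * t)) by ring.
    rewrite Rabs_mult, (Rabs_pos_eq (exp (- sigma * t))) by lra.
    rewrite <- (Rmult_assoc (Y + r + sigma)). apply Rmult_le_compat_r; [lra|].
    apply Rle_trans with (1 := Rabs_triang _ _).
    apply Rle_trans with (1 := Rplus_le_compat_r _ _ _ (Rabs_triang _ _)).
    rewrite !Rabs_mult, Rabs_Ropp, (Rabs_pos_eq sigma) by lra.
    assert (H1 : Rabs (c' t) * Rabs (p t) <= Y * exp (r * t))
      by (apply Rmult_le_compat; auto using Rabs_pos).
    assert (H2 : Rabs (c t) * Rabs (p' t) <= 1 * (r * exp (r * t)))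
      by (apply Rmult_le_compat; auto using Rabs_pos).
    assert (H3 : Rabs (c t) * Rabs (p t) <= 1 * exp (r * t))
      by (apply Rmult_le_compat; auto using Rabs_pos).
    nra.
Qed.

(** Sequences start at index 0, so index [j] stands for the integer [j + 1]. *)
Definition log_succ (j : nat) : R := ln (INR (S j)).

Lemma INR_S_pos (j : nat) : 0 < INR (S j).
Proof. apply lt_0_INR; lia. Qed.

Lemma log_succ_le (i j : nat) : (i <= j)%nat -> log_succ i <= log_succ j.
Proof.
  intro H. apply ln_le; [apply INR_S_pos | apply le_INR; lia].
Qed.

Lemma log_succ_nonneg (j : nat) : 0 <= log_succ j.
Proof.
  replace 0 with (log_succ 0) by (unfold log_succ; simpl; apply ln_1).
  apply log_succ_le. lia.
Qed.

(** Grouping the terms of odd and even integers two by two makes the alternating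
    series absolutely convergent for all [sigma > 0]. *)
Definition pair_difference (f : R -> R) (m : nat) : R :=
  f (log_succ (2 * m)) - f (log_succ (2 * m + 1)).

Lemma exp_decay_le (delta a b : R) :
  0 < delta -> a <= b -> exp (- delta * b) <= exp (- delta * a).
Proof.
  intros Hd H. destruct H as [H| ->]; [|lra].
  left. apply exp_increasing. nra.
Qed.

(** The pairs are disjoint pieces of a decreasing positive sequence, so their
    sum is at most its first term. *)
Lemma ex_series_pair_decay (delta : R) :
  0 < delta -> ex_series (pair_difference (fun L => exp (- delta * L))).
Proof.
  intro Hd. set (e := fun L => exp (- delta * L)).
  assert (Hmono : forall i j, (i <= j)%nat -> e (log_succ j) <= e (log_succ i)).
  { intros i j H. now apply exp_decay_le, log_succ_le. }
  assert (Hpos : forall j, 0 < e (log_succ j)) by (intro; apply exp_pos).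
  destruct (ex_finite_lim_seq_incr (sum_f_R0 (pair_difference e)) (e (log_succ 0)))
    as [l Hl].
  - intro n. rewrite tech5. unfold pair_difference at 3.
    assert (H := Hmono (2 * S n)%nat (2 * S n + 1)%nat ltac:(lia)). lra.
  - intro n.
    assert (sum_f_R0 (pair_difference e) n <= e (log_succ 0) - e (log_succ (2 * n + 1))).
    { induction n as [|n IH].
      - simpl. unfold pair_difference. simpl. lra.
      - rewrite tech5. unfold pair_difference at 2.
        assert (H := Hmono (2 * n + 1)%nat (2 * S n)%nat ltac:(lia)). lra. }
    specialize (Hpos (2 * n + 1)%nat). lra.
  - exists l. now apply is_series_R_sum.
Qed.

Definition exp_sum (K : nat) (t : R) : R :=
  sum_f_R0 (fun k => t ^ k / INR (Factorial.fact k)) K.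

Lemma exp_sum_lim (t : R) : is_lim_seq (fun K => exp_sum K t) (exp t).
Proof.
  apply is_series_R_sum.
  apply is_series_ext with (fun k => / INR (Factorial.fact k) * t ^ k).
  { intro k. unfold Rdiv. apply Rmult_comm. }
  apply is_series_exp.
Qed.

Lemma exp_sum_bound (K : nat) (t b : R) : Rabs t <= b -> Rabs (exp_sum K t) <= exp b.
Proof.
  intro Hb.
  apply Rle_trans with (exp_sum K (Rabs t)).
  - unfold exp_sum. apply Rle_trans with (1 := Rsum_abs _ _). right.
    apply sum_eq. intros k _. unfold Rdiv.
    rewrite Rabs_mult, <- RPow_abs, (Rabs_pos_eq (/ _)); auto.
    left. apply Rinv_0_lt_compat, INR_fact_lt_0.
  - apply Rle_trans with (exp (Rabs t)).
    + apply (is_lim_seq_incr_compare (fun K => exp_sum K (Rabs t)) (exp (Rabs t))).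
      * apply exp_sum_lim.
      * intro n. unfold exp_sum. rewrite tech5.
        assert (0 <= Rabs t ^ S n / INR (Factorial.fact (S n))); [|lra].
        apply Rmult_le_pos; [apply pow_le, Rabs_pos|].
        left. apply Rinv_0_lt_compat, INR_fact_lt_0.
    + destruct Hb as [Hb|Hb]; [left; now apply exp_increasing | rewrite Hb; lra].
Qed.

Definition exp_sum' (K : nat) (t : R) : R :=
  match K with O => 0 | S K => exp_sum K t end.

Lemma exp_sum_derive (K : nat) (t : R) : is_derive (exp_sum K) t (exp_sum' K t).
Proof.
  induction K as [|K IH].
  - apply is_derive_ext with (fun _ => 1).
    { intro z. unfold exp_sum. simpl. field. }
    apply (is_derive_const 1).
  - apply is_derive_ext with (fun z => exp_sum K z + z ^ S K / INR (Factorial.fact (S K))).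
    { intro z. reflexivity. }
    replace (exp_sum' (S K) t)
      with (exp_sum' K t + t ^ K / INR (Factorial.fact K)).
    2: { destruct K; simpl exp_sum'; [|reflexivity].
         unfold exp_sum; simpl; field. }
    apply (is_derive_plus (exp_sum K)); [exact IH|].
    assert (Hf := INR_fact_neq_0 K). assert (HS := INR_S_pos K).
    auto_derive; auto.
    change (match K with O => 1 | S _ => INR K + 1 end) with (INR (S K)).
    change (Factorial.fact K + K * Factorial.fact K)%nat with (S K * Factorial.fact K)%nat.
    rewrite mult_INR.
    field. split; lra.
Qed.

(** For [c] equal to [cos (y * L)], respectively [- sin (y * L)], this is the real,
    respectively imaginary, part of [(1 - 2^(1-s)) zeta s] at
    [s = sigma + iy]. *)
Definition eta_part (c : R -> R) (sigma : R) : R :=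
  Series (pair_difference (fun L => c L * exp (- sigma * L))).

Lemma pair_difference_bound (c p p' : R -> R) (Y sigma r : R) (m : nat) :
  slowly_varying Y c -> 0 <= r < sigma ->
  (forall L, is_derive p L (p' L)) ->
  (forall L, 0 <= L -> Rabs (p L) <= exp (r * L)) ->
  (forall L, 0 <= L -> Rabs (p' L) <= r * exp (r * L)) ->
  Rabs (pair_difference (fun L => c L * p L * exp (- sigma * L)) m)
  <= (Y + r + sigma) / (sigma - r)
     * pair_difference (fun L => exp (- (sigma - r) * L)) m.
Proof.
  intros. apply damped_difference with p'; auto.
  split; [apply log_succ_nonneg | apply log_succ_le; lia].
Qed.

(** Expand each [exp (- (sigma + w) * L)] in powers of [w] and exchange the sums
    over the powers and over the pairs.  The pairs built with Taylor polynomials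
    are dominated uniformly in their degree, so [tannery] justifies the
    exchange. *)
Lemma real_analytic_at_eta_part (c : R -> R) (Y sigma : R) :
  slowly_varying Y c -> 0 < sigma -> real_analytic_at (eta_part c) sigma.
Proof.
  intros Hc Hs. set (r := sigma / 2).
  exists r, (fun k => Series (pair_difference
    (fun L => c L * ((- L) ^ k / INR (Factorial.fact k)) * exp (- sigma * L)))).
  split; [unfold r; lra|]. intros w Hw.
  (* [Series (u K)] is the partial sum of degree [K] of the claimed expansion. *)
  set (u := fun K => pair_difference
    (fun L => c L * exp_sum K (- w * L) * exp (- sigma * L))).
  set (B := fun m => (Y + r + sigma) / (sigma - r)
     * pair_difference (fun L => exp (- (sigma - r) * L)) m).
  assert (HB : ex_series B).
  { apply (ex_series_scal (V := R_NormedModule) ((Y + r + sigma) / (sigma - r))).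
    apply ex_series_pair_decay. unfold r; lra. }
  assert (Habs : forall L, 0 <= L -> Rabs (- w * L) <= r * L).
  { intros L HL. rewrite Rabs_mult, Rabs_Ropp, (Rabs_pos_eq L) by auto.
    apply Rmult_le_compat_r; lra. }
  assert (Hu : forall K m, Rabs (u K m) <= B m).
  { intros K m.
    apply (pair_difference_bound c (fun L => exp_sum K (- w * L))
             (fun L => - w * exp_sum' K (- w * L)) Y sigma r m); auto.
    - unfold r; lra.
    - intro L. apply (is_derive_comp (exp_sum K) (fun L => - w * L)).
      + apply exp_sum_derive.
      + auto_derive; auto; ring.
    - intros L HL. apply exp_sum_bound; auto.
    - intros L HL. rewrite Rabs_mult, Rabs_Ropp.
      apply Rmult_le_compat; try apply Rabs_pos; [lra|].
      destruct K; simpl.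
      + rewrite Rabs_R0. left; apply exp_pos.
      + apply exp_sum_bound; auto. }
  apply is_pseries_R, is_series_R_sum.
  assert (Hex : forall K, ex_series (u K)).
  { intro K. now apply (ex_series_dominated _ B). }
  apply is_lim_seq_ext with (fun K => Series (u K)).
  { intro K. induction K as [|K IH].
    - simpl. rewrite Rmult_1_r. apply Series_ext. intro m.
      unfold u, pair_difference, exp_sum. simpl. reflexivity.
    - rewrite tech5, <- IH, <- Series_scal_r.
      apply Rplus_eq_reg_l with (- Series (u K)).
      rewrite <- Rplus_assoc, Rplus_opp_l, Rplus_0_l, Rplus_comm.
      fold (Series (u (S K)) - Series (u K)).
      rewrite <- Series_minus by auto.
      apply Series_ext. intro m.
      unfold u, pair_difference, exp_sum. rewrite !tech5.
      replace (- w) with (w * - 1) by ring.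
      rewrite !Rmult_assoc, !(Rpow_mult_distr w).
      set (a := log_succ (2 * m)). set (b := log_succ (2 * m + 1)).
      replace (- a) with (-1 * a) by ring. replace (- b) with (-1 * b) by ring.
      unfold Rdiv. ring. }
  apply (tannery u _ B); auto.
  assert (Hlim : forall L, is_lim_seq
    (fun K => c L * exp_sum K (- w * L) * exp (- sigma * L))
    (c L * exp (- (sigma + w) * L))).
  { intro L.
    replace (exp (- (sigma + w) * L)) with (exp (- w * L) * exp (- sigma * L))
      by (rewrite <- exp_plus; f_equal; ring).
    rewrite <- Rmult_assoc.
    apply is_lim_seq_mult'; [|apply is_lim_seq_const].
    apply is_lim_seq_mult'; [apply is_lim_seq_const | apply exp_sum_lim]. }
  intro m. apply is_lim_seq_minus'; apply Hlim.
Qed.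
(** * Zeta on a horizontal line *)

Lemma is_series_C_parts (u : nat -> C) (l : C) :
  @is_series C_AbsRing C_NormedModule u l <->
  is_series (fun n => Re (u n)) (Re l) /\ is_series (fun n => Im (u n)) (Im l).
Proof.
  assert (HRe : forall n, Re (@sum_n C_NormedModule u n) = sum_n (fun n => Re (u n)) n).
  { induction n as [|n IH]; [now rewrite !sum_O|].
    rewrite !sum_Sn, <- IH. reflexivity. }
  assert (HIm : forall n, Im (@sum_n C_NormedModule u n) = sum_n (fun n => Im (u n)) n).
  { induction n as [|n IH]; [now rewrite !sum_O|].
    rewrite !sum_Sn, <- IH. reflexivity. }
  assert (HC := @filterlim_locally nat C_UniformSpace eventually _
                  (@sum_n C_NormedModule u) l).
  assert (HR := fun v k => @filterlim_locally nat R_UniformSpace eventually _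
                             (@sum_n R_NormedModule v) k).
  split.
  - intro H. split; apply HR; intro eps; generalize (proj1 HC H eps); apply filter_imp;
      intros n [Hr Hi]; [rewrite <- HRe | rewrite <- HIm]; assumption.
  - intros [Hr Hi]. apply HC. intro eps.
    generalize (filter_and _ _ (proj1 (HR _ _) Hr eps) (proj1 (HR _ _) Hi eps)).
    apply filter_imp.
    intros n [H1 H2]. rewrite <- HRe in H1. rewrite <- HIm in H2. now split.
Qed.

Lemma pow_n_RtoC (t : R) (n : nat) :
  @pow_n C_AbsRing (RtoC t) n = RtoC (t ^ n).
Proof.
  induction n as [|n IH]; [reflexivity|].
  simpl. rewrite IH. unfold mult; simpl. now rewrite <- RtoC_mult.
Qed.

Lemma real_analytic_at_line (f : C -> C) (y sigma : R) :
  analytic_at f (sigma, y) ->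
  real_analytic_at (fun t => Re (f (t, y))) sigma /\
  real_analytic_at (fun t => Im (f (t, y))) sigma.
Proof.
  intros (r & a & Hr & H).
  assert (Hw : forall w, Rabs w < r ->
    is_pseries (fun k => Re (a k)) w (Re (f ((sigma + w)%R, y))) /\
    is_pseries (fun k => Im (a k)) w (Im (f ((sigma + w)%R, y)))).
  { intros w Hw.
    assert (E : (((sigma + w)%R, y) - (sigma, y))%C = RtoC w).
    { unfold RtoC, Cminus, Cplus, Copp; simpl; f_equal; ring. }
    specialize (H ((sigma + w)%R, y)). rewrite E, Cmod_R in H.
    destruct (proj1 (is_series_C_parts _ _) (H Hw)) as [HR HI].
    rewrite !is_pseries_R.
    split; (eapply is_series_ext; [|first [exact HR | exact HI]]);
      intro k; simpl; rewrite pow_n_RtoC; unfold scal; simpl; unfold mult; simpl; unfold Re, Im; ring. }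
  split; [exists r, (fun k => Re (a k)) | exists r, (fun k => Im (a k))];
    (split; [exact Hr|]); intros w Hww; apply (Hw w Hww).
Qed.

Lemma dirichlet_term_parts (sigma y : R) (j : nat) :
  Re (dirichlet_term (sigma, y) (S j))
    = cos (y * log_succ j) * exp (- sigma * log_succ j) /\
  Im (dirichlet_term (sigma, y) (S j))
    = - sin (y * log_succ j) * exp (- sigma * log_succ j).
Proof.
  unfold dirichlet_term. fold (log_succ j). generalize (log_succ j). intro L.
  unfold Cexp, RtoC, Copp, Cmult. cbn [Re Im fst snd].
  replace (- sigma * L - - y * 0) with (- sigma * L) by ring.
  replace (- sigma * 0 + - y * L) with (- (y * L)) by ring.
  rewrite cos_neg, sin_neg. split; ring.
Qed.

Lemma log_succ_double (m : nat) : log_succ (2 * m + 1) = ln 2 + log_succ m.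
Proof.
  unfold log_succ. rewrite <- ln_mult by (try apply INR_S_pos; lra).
  f_equal. replace (S (2 * m + 1)) with (2 * S m)%nat by lia.
  now rewrite mult_INR.
Qed.

(** Subtracting twice the odd-indexed terms changes their signs, here with the
    terms grouped in pairs. *)
Lemma is_series_pairs (e : nat -> R) (l l' : R) :
  is_series e l -> is_series (fun m => e (2 * m + 1)%nat) l' ->
  is_series (fun m => e (2 * m)%nat - e (2 * m + 1)%nat) (l - 2 * l').
Proof.
  rewrite !is_series_R_sum. intros H H'.
  apply is_lim_seq_ext with (fun N => sum_f_R0 e (2 * N + 1)
    - 2 * sum_f_R0 (fun m => e (2 * m + 1)%nat) N).
  - induction n as [|n IH].
    + simpl. ring.
    + rewrite (tech5 (fun m => e (2 * m)%nat - e (2 * m + 1)%nat)), <- IH.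
      rewrite (tech5 (fun m => e (2 * m + 1)%nat)).
      replace (2 * S n + 1)%nat with (S (S (2 * n + 1))) by lia.
      rewrite !(tech5 e).
      replace (2 * S n)%nat with (S (2 * n + 1)) by lia. ring.
  - apply is_lim_seq_minus'.
    + apply (is_lim_seq_subseq (sum_f_R0 e) l (fun N => (2 * N + 1)%nat)); auto.
      apply eventually_subseq. intro n; lia.
    + apply is_lim_seq_mult'; [apply is_lim_seq_const | exact H'].
Qed.

(** In complex form this is [eta s = (1 - 2 * 2^(-s)) * zeta s] with
    [2^(-s) = A - i * B]: the even integers contribute [2^(-s) * zeta s] to
    zeta, and their sign has to be changed. *)
Lemma eta_part_right (zeta : C -> C) (y sigma : R) :
  is_Riemann_zeta zeta -> 1 < sigma ->
  let U := Re (zeta (sigma, y)) in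
  let V := Im (zeta (sigma, y)) in
  let A := exp (- ln 2 * sigma) * cos (y * ln 2) in
  let B := exp (- ln 2 * sigma) * sin (y * ln 2) in
  eta_part (fun L => cos (y * L)) sigma = U - 2 * (A * U + B * V) /\
  eta_part (fun L => - sin (y * L)) sigma = V - 2 * (A * V - B * U).
Proof.
  intros [Hz _] Hs U V A B.
  destruct (proj1 (is_series_C_parts _ _) (Hz (sigma, y) Hs)) as [HR HI].
  set (re := fun j => cos (y * log_succ j) * exp (- sigma * log_succ j)).
  set (im := fun j => - sin (y * log_succ j) * exp (- sigma * log_succ j)).
  assert (Hre : is_series re U).
  { eapply is_series_ext; [|exact HR]. intro j. apply dirichlet_term_parts. }
  assert (Him : is_series im V).
  { eapply is_series_ext; [|exact HI]. intro j. apply dirichlet_term_parts. }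
  assert (Hexp : forall m, exp (- sigma * (ln 2 + log_succ m))
            = exp (- ln 2 * sigma) * exp (- sigma * log_succ m)).
  { intro m. rewrite <- exp_plus. f_equal; ring. }
  split; apply is_series_unique.
  - apply (is_series_pairs re); auto.
    eapply is_series_ext;
      [|exact (is_series_plus _ _ _ _ (is_series_scal (V := R_NormedModule) A _ _ Hre)
                 (is_series_scal (V := R_NormedModule) B _ _ Him))].
    intro m. unfold re, im. rewrite log_succ_double, Rmult_plus_distr_l, cos_plus, Hexp.
    unfold plus, scal; simpl; unfold mult; simpl. unfold A, B. ring.
  - apply (is_series_pairs im); auto.
    replace (A * V - B * U) with (A * V + - B * U) by ring.
    eapply is_series_ext;
      [|exact (is_series_plus _ _ _ _ (is_series_scal (V := R_NormedModule) A _ _ Him)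
                 (is_series_scal (V := R_NormedModule) (- B) _ _ Hre))].
    intro m. unfold re, im. rewrite log_succ_double, Rmult_plus_distr_l, sin_plus, Hexp.
    unfold plus, scal; simpl; unfold mult; simpl. unfold A, B. ring.
Qed.

(** The shape of the difference between the two sides of [eta_part_right]. *)
Lemma real_analytic_at_euler_factor (F U V A B : R -> R) (t0 : R) :
  real_analytic_at F t0 -> real_analytic_at U t0 -> real_analytic_at V t0 ->
  real_analytic_at A t0 -> real_analytic_at B t0 ->
  real_analytic_at (fun t => F t - (U t - 2 * (A t * U t + B t * V t))) t0.
Proof.
  intros HF HU HV HA HB.
  apply (real_analytic_at_plus F (fun t => - (U t - 2 * (A t * U t + B t * V t)))); auto.
  apply real_analytic_at_opp.
  apply (real_analytic_at_plus U (fun t => - (2 * (A t * U t + B t * V t)))); auto.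
  apply real_analytic_at_opp.
  apply (real_analytic_at_mult (fun _ => 2) (fun t => A t * U t + B t * V t));
    [apply real_analytic_at_const|].
  apply (real_analytic_at_plus (fun t => A t * U t) (fun t => B t * V t));
    apply real_analytic_at_mult; auto.
Qed.

(** Both sides of [eta_part_right] are analytic along the line at height [y], so
    the relation extends from [Re s > 1] to [Re s > 0], where a zero of zeta makes
    its right-hand side vanish. *)
Lemma eta_part_zero (zeta : C -> C) (x y : R) :
  is_Riemann_zeta zeta -> 0 < x -> y <> 0 -> zeta (x, y) = RtoC 0 ->
  eta_part (fun L => cos (y * L)) x = 0 /\
  eta_part (fun L => - sin (y * L)) x = 0.
Proof.
  intros Hz Hx Hy H0.
  set (U := fun t => Re (zeta (t, y))). set (V := fun t => Im (zeta (t, y))).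
  set (A := fun t => exp (- ln 2 * t) * cos (y * ln 2)).
  set (B := fun t => exp (- ln 2 * t) * sin (y * ln 2)).
  assert (HUV : forall t, real_analytic_at U t /\ real_analytic_at V t).
  { intro t. apply real_analytic_at_line, Hz. intro E.
    apply Hy. exact (f_equal Im E). }
  assert (HA : forall t, real_analytic_at A t).
  { intro t. apply (real_analytic_at_mult (fun t => exp (- ln 2 * t)));
      [apply real_analytic_at_exp | apply real_analytic_at_const]. }
  assert (HB : forall s t, real_analytic_at (fun t => s * B t) t).
  { intros s t. apply (real_analytic_at_mult (fun _ => s) B);
      [apply real_analytic_at_const|].
    apply (real_analytic_at_mult (fun t => exp (- ln 2 * t)));
      [apply real_analytic_at_exp | apply real_analytic_at_const]. }
  assert (Hc := identity_theorem_half_line _ 0 1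
    (fun t Ht => real_analytic_at_euler_factor _ U V A _ t
       (real_analytic_at_eta_part _ _ t (slowly_varying_cos y) Ht)
       (proj1 (HUV t)) (proj2 (HUV t)) (HA t) (HB 1 t))).
  assert (Hs := identity_theorem_half_line _ 0 1
    (fun t Ht => real_analytic_at_euler_factor _ V U A _ t
       (real_analytic_at_eta_part _ _ t (slowly_varying_sin y) Ht)
       (proj2 (HUV t)) (proj1 (HUV t)) (HA t) (HB (-1) t))).
  cbv beta in Hc, Hs.
  assert (HU0 : U x = 0) by (unfold U; now rewrite H0).
  assert (HV0 : V x = 0) by (unfold V; now rewrite H0).
  split.
  - cut (eta_part (fun L => cos (y * L)) x
         - (U x - 2 * (A x * U x + 1 * B x * V x)) = 0); [rewrite HU0, HV0; lra|].
    apply Hc; [|exact Hx]. intros t Ht.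
    rewrite (proj1 (eta_part_right zeta y t Hz Ht)). unfold U, V, A, B. ring.
  - cut (eta_part (fun L => - sin (y * L)) x
         - (V x - 2 * (A x * V x + -1 * B x * U x)) = 0); [rewrite HU0, HV0; lra|].
    apply Hs; [|exact Hx]. intros t Ht.
    rewrite (proj2 (eta_part_right zeta y t Hz Ht)). unfold U, V, A, B. ring.
Qed.

(** * Correlations of the alternating series at a zero *)

Lemma is_lim_seq_power_decay (x : R) :
  0 < x -> is_lim_seq (fun n => exp (- x * log_succ n)) 0.
Proof.
  intro Hx.
  apply (is_lim_comp_seq exp (fun n => - x * log_succ n) m_infty 0).
  - apply is_lim_exp_m.
  - exists O. intros n _. discriminate.
  - replace m_infty with (Rbar_mult (- x) p_infty).
    + apply is_lim_seq_scal_l.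
      apply (is_lim_comp_seq ln (fun n => INR (S n)) p_infty p_infty).
      * apply is_lim_ln_p.
      * exists O. intros n _. discriminate.
      * apply -> (is_lim_seq_incr_1 INR). apply is_lim_seq_INR.
    + apply is_Rbar_mult_unique, is_Rbar_mult_sym, is_Rbar_mult_p_infty_neg. simpl; lra.
Qed.

Definition eta_term (c : R -> R) (x : R) (n : nat) : R :=
  (-1) ^ n * (c (log_succ n) * exp (- x * log_succ n)).

(** [autocorrelation_series] for the alternating series, with
    [phi n = (n + 1)^(-x)]; the vanishing of [eta_part] supplies the bound on
    the partial sums. *)
Lemma eta_autocorrelation (c : R -> R) (Y x : R) :
  slowly_varying Y c -> 0 < x -> eta_part c x = 0 ->
  ex_series (fun n => exp (- x * log_succ n) ^ 2) ->
  let a := eta_term c x in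
  ex_series (fun n => a n ^ 2) /\
  (forall k, ex_series (fun n => a n * a (n + S k)%nat)) /\
  is_series (fun k => Series (fun n => a n * a (n + S k)%nat))
    (- / 2 * Series (fun n => (a n) ^ 2)).
Proof.
  intros Hc Hx Heta Hsum a.
  set (phi := fun n => exp (- x * log_succ n)).
  assert (Hc1 : forall L, Rabs (c L) <= 1) by (destruct Hc as [c' Hc]; apply Hc).
  assert (HY : 0 <= Y).
  { destruct Hc as [c' Hc]. destruct (Hc 0) as (_ & _ & H).
    apply Rle_trans with (2 := H), Rabs_pos. }
  assert (Ha : forall n, Rabs (a n) <= phi n).
  { intro n. unfold a, eta_term. rewrite !Rabs_mult, pow_1_abs, Rmult_1_l.
    fold (phi n). rewrite (Rabs_pos_eq (phi n)) by (left; apply exp_pos).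
    rewrite <- (Rmult_1_l (phi n)) at 2.
    apply Rmult_le_compat_r; [left; apply exp_pos | apply Hc1]. }
  assert (Hmono : forall n m, (n <= m)%nat -> phi m <= phi n).
  { intros n m H. now apply exp_decay_le, log_succ_le. }
  assert (Hphi := is_lim_seq_power_decay x Hx).
  set (M := (Y + 0 + x) / (x - 0)).
  assert (HM0 : 0 <= M).
  { apply Rmult_le_pos; [lra | left; apply Rinv_0_lt_compat; lra]. }
  assert (Hdiff : forall i j, (i <= j)%nat ->
    Rabs (c (log_succ i) * phi i - c (log_succ j) * phi j) <= M * (phi i - phi j)).
  { intros i j Hij.
    assert (H := damped_difference c (fun _ => 1) (fun _ => 0) Y x 0
                   (log_succ i) (log_succ j) Hc ltac:(lra)).
    rewrite !Rmult_1_r, Rminus_0_r in H. fold (phi i) (phi j) in H.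
    unfold M. rewrite Rminus_0_r. apply H.
    - intro L. apply (is_derive_const 1).
    - intros L HL. rewrite Rmult_0_l, exp_0, Rabs_R1. lra.
    - intros L HL. rewrite Rabs_R0. lra.
    - split; [apply log_succ_nonneg | now apply log_succ_le]. }
  assert (Heven : forall m, (-1) ^ (2 * m) = 1) by apply pow_1_even.
  assert (Hodd : is_lim_seq (fun m => sum_f_R0 a (2 * m + 1)) 0).
  { apply is_lim_seq_ext with
      (sum_f_R0 (pair_difference (fun L => c L * exp (- x * L)))).
    { intro m. induction m as [|m IH].
      - simpl. unfold pair_difference, a, eta_term. simpl. ring.
      - replace (2 * S m + 1)%nat with (S (S (2 * m + 1))) by lia.
        rewrite (tech5 _ m), IH, !(tech5 a).
        unfold pair_difference, a, eta_term.
        replace (S (S (2 * m + 1))) with (S (2 * S m)) by lia.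
        replace (S (2 * m + 1)) with (2 * S m)%nat by lia.
        rewrite <- (tech_pow_Rmult (-1) (2 * S m)), Heven, (Nat.add_1_r (2 * S m)).
        ring. }
    apply is_series_R_sum. rewrite <- Heta. apply Series_correct.
    apply (ex_series_dominated _ (fun m => M * pair_difference (fun L => exp (- x * L)) m)).
    - intro m. apply Hdiff. lia.
    - apply (ex_series_scal (V := R_NormedModule) M). now apply ex_series_pair_decay. }
  assert (HA : forall n, Rabs (sum_f_R0 a n) <= M * phi n).
  { apply alternating_sum_bound; auto.
    intro n. unfold a, eta_term. rewrite <- tech_pow_Rmult.
    replace ((-1) ^ n * (c (log_succ n) * exp (- x * log_succ n)) +
             -1 * (-1) ^ n * (c (log_succ (S n)) * exp (- x * log_succ (S n))))
      with ((-1) ^ n * (c (log_succ n) * phi n - c (log_succ (S n)) * phi (S n)))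
      by (unfold phi; ring).
    rewrite Rabs_mult, pow_1_abs, Rmult_1_l. apply Hdiff. lia. }
  split.
  - apply (ex_series_dominated _ (fun n => phi n ^ 2)); auto.
    intro n. rewrite <- RPow_abs. apply pow_incr. split; [apply Rabs_pos | apply Ha].
  - now apply (autocorrelation_series a phi M).
Qed.

(** The products of the real parts and of the imaginary parts of two terms
    combine, through [cos (u - v)], into the summand of [Zfun]; the sign
    [(-1)^n * (-1)^(n + k)] of each product is the alternating sign
    [(-1)^k]. *)
Theorem theorem1 (zeta : C -> C) (hzeta : is_Riemann_zeta zeta)
    (x y : R)
    (hstrip : critical_half_strip (RtoC x + Ci * RtoC y)%C)
    (hzero : nontrivial_zero zeta (RtoC x + Ci * RtoC y)%C) :
  @is_series C_AbsRing C_NormedModule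
    (fun j : nat =>
       let k := S j in
       (RtoC ((-1) ^ (k + 1)) * Zfun zeta (k + 1) x y)%C)
    (RtoC (1 / 2)).
Proof.
  assert (Es : (RtoC x + Ci * RtoC y)%C = (x, y)).
  { unfold RtoC, Ci, Cplus, Cmult; simpl; f_equal; ring. }
  rewrite Es in hstrip, hzero. clear Es.
  destruct hstrip as [[Hx _] Hy]. destruct hzero as [H0 _]. simpl in Hx, Hy.
  destruct (eta_part_zero zeta x y hzeta) as [Hcos Hsin]; [lra | lra | exact H0 |].
  set (phi := fun n => exp (- x * log_succ n)).
  set (z := Series (fun n => phi n ^ 2)).
  assert (Hz2 : is_series (fun n => phi n ^ 2) z /\ zeta (RtoC (2 * x)) = RtoC z).
  { destruct hzeta as [Hz _].
    destruct (proj1 (is_series_C_parts _ _) (Hz (RtoC (2 * x)) ltac:(simpl; lra)))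
      as [HR HI].
    assert (Hphi : is_series (fun n => phi n ^ 2) (Re (zeta (RtoC (2 * x))))).
    { eapply is_series_ext; [|exact HR]. intro n.
      transitivity (cos (0 * log_succ n) * exp (- (2 * x) * log_succ n));
        [exact (proj1 (dirichlet_term_parts (2 * x) 0 n))|].
      rewrite Rmult_0_l, cos_0, Rmult_1_l. unfold phi.
      simpl pow. rewrite Rmult_1_r, <- exp_plus. f_equal. ring. }
    assert (HIm : Im (zeta (RtoC (2 * x))) = 0).
    { rewrite <- (is_series_unique _ _ HI). apply is_series_unique, is_series_R_sum.
      apply is_lim_seq_ext with (fun _ => 0); [|apply is_lim_seq_const].
      intro N. rewrite (sum_eq _ (fun _ => 0)), sum_cte; [ring|].
      intros n _. transitivity (- sin (0 * log_succ n) * exp (- (2 * x) * log_succ n));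
        [exact (proj2 (dirichlet_term_parts (2 * x) 0 n))|].
      rewrite Rmult_0_l, sin_0. ring. }
    unfold z. rewrite (is_series_unique _ _ Hphi). split; [exact Hphi|].
    unfold RtoC at 2. rewrite <- HIm. now destruct (zeta (RtoC (2 * x))). }
  destruct Hz2 as [Hphi Hzeta2].
  assert (Hzpos : 0 < z).
  { apply Rlt_le_trans with (sum_f_R0 (fun n => phi n ^ 2) 0); [apply pow_lt, exp_pos|].
    apply (is_lim_seq_incr_compare (sum_f_R0 (fun n => phi n ^ 2)) z);
      [now apply is_series_R_sum|].
    intro n. rewrite tech5. assert (H := pow2_ge_0 (phi (S n))). lra. }
  assert (Hexphi : ex_series (fun n => phi n ^ 2)) by (now exists z).
  set (a := eta_term (fun L => cos (y * L)) x).
  set (b := eta_term (fun L => - sin (y * L)) x).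
  destruct (eta_autocorrelation _ _ x (slowly_varying_cos y) ltac:(lra) Hcos Hexphi)
    as (Hexa2 & Hexa & Hseriesa).
  destruct (eta_autocorrelation _ _ x (slowly_varying_sin y) ltac:(lra) Hsin Hexphi)
    as (Hexb2 & Hexb & Hseriesb).
  fold a in Hexa2, Hexa, Hseriesa. fold b in Hexb2, Hexb, Hseriesb.
  assert (Hsign : forall n, (-1) ^ n * (-1) ^ n = 1).
  { intro n. rewrite <- Rpow_mult_distr. replace (-1 * -1) with 1 by ring. apply pow1. }
  assert (Hab2 : Series (fun n => a n ^ 2) + Series (fun n => b n ^ 2) = z).
  { rewrite <- Series_plus by assumption. apply Series_ext. intro n.
    unfold a, b, eta_term. fold (phi n).
    assert (Htrig := sin2_cos2 (y * log_succ n)). unfold Rsqr in Htrig.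
    transitivity (((-1) ^ n * (-1) ^ n)
      * (sin (y * log_succ n) * sin (y * log_succ n)
         + cos (y * log_succ n) * cos (y * log_succ n)) * phi n ^ 2); [ring|].
    rewrite Htrig, Hsign. ring. }
  assert (Hcorr : forall j,
    Series (fun i => cos (y * ln (1 + INR (S j) / INR (S i)))
                     / Rpower (INR (S i) * INR (S i + S j)) x)
    = (-1) ^ S j * (Series (fun n => a n * a (n + S j)%nat)
                    + Series (fun n => b n * b (n + S j)%nat))).
  { intro j. rewrite <- (Series_plus _ _ (Hexa j) (Hexb j)), <- Series_scal_l.
    apply Series_ext. intro i.
    assert (Hi := INR_S_pos i). assert (Hij := INR_S_pos (i + S j)).
    replace (1 + INR (S j) / INR (S i)) with (INR (S (i + S j)) / INR (S i)).
    2: { replace (S (i + S j)) with (S i + S j)%nat by lia. rewrite plus_INR. field. lra. }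
    replace (S i + S j)%nat with (S (i + S j)) by lia.
    replace (ln (INR (S (i + S j)) / INR (S i))) with (log_succ (i + S j) - log_succ i).
    2: { unfold Rdiv. rewrite ln_mult, ln_Rinv; auto using Rinv_0_lt_compat. }
    unfold Rpower. rewrite ln_mult by auto.
    unfold Rdiv. rewrite <- exp_Ropp. fold (log_succ i) (log_succ (i + S j)).
    replace (- (x * (log_succ i + log_succ (i + S j))))
      with (- x * log_succ i + - x * log_succ (i + S j)) by ring.
    replace (y * (log_succ (i + S j) - log_succ i))
      with (y * log_succ (i + S j) - y * log_succ i) by ring.
    rewrite exp_plus, cos_minus. unfold a, b, eta_term. rewrite pow_add.
    fold (phi i) (phi (i + S j)%nat).
    set (C := cos _ * cos _ + sin _ * sin _).
    transitivity ((((-1) ^ i * (-1) ^ i) * ((-1) ^ S j * (-1) ^ S j))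
                  * (C * (phi i * phi (i + S j)%nat))).
    - rewrite !Hsign. ring.
    - unfold C. ring. }
  set (corr := fun j => Series (fun n => a n * a (n + S j)%nat)
                        + Series (fun n => b n * b (n + S j)%nat)).
  assert (Hterm : forall j, RtoC (- / z * corr j)
    = (RtoC ((-1) ^ (S j + 1)) * Zfun zeta (S j + 1) x y)%C).
  { intro j. unfold Zfun. rewrite Hzeta2.
    replace (S j + 1 - 1)%nat with (S j) by lia. cbv zeta. rewrite Hcorr.
    fold (corr j). rewrite <- RtoC_div, <- !RtoC_mult by lra. f_equal.
    rewrite pow_add, pow_1.
    transitivity (- / z * corr j * ((-1) ^ S j * (-1) ^ S j)).
    - rewrite Hsign. ring.
    - field. lra. }
  apply (@is_series_ext C_AbsRing C_NormedModule) with (1 := Hterm).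
  apply is_series_C_parts. split.
  - simpl. replace (1 / 2) with (- / z * (- / 2 * Series (fun n => a n ^ 2)
                                          + - / 2 * Series (fun n => b n ^ 2))).
    + apply (is_series_scal (V := R_NormedModule) (- / z)).
      now apply (is_series_plus (V := R_NormedModule)).
    + rewrite <- Rmult_plus_distr_l, Hab2. field. lra.
  - simpl. apply is_series_R_sum.
    apply is_lim_seq_ext with (fun _ => 0); [|apply is_lim_seq_const].
    intro N. rewrite sum_cte. ring.
Qed.
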